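(* Let $n\ge2$ be an integer. For $a,b,c,d\in2\mathbb N$ define $$f(a,b,c,d)=\frac{I_n\begin{pmatrix}a&c\\ b&d\end{pmatrix}}{(a+d+n-2)!!\,(b+c+n-2)!!}.$$ Then $f$ is a symmetric function of $(a,b,c,d)$ on $(2\mathbb N)^4$, i.e. invariant under all permutations of its four arguments.
   Context: $I_n\begin{pmatrix}a&c\\ b&d\end{pmatrix}=\int_{O_n}u_{11}^a\,u_{12}^c\,u_{21}^b\,u_{22}^d\,du$ with respect to the Haar probability measure on $O_n$. Double factorial convention: for an integer $m\ge0$, $m!!=(m-1)(m-3)\cdots$, the product of the positive integers $\le m-1$ of the parity of $m-1$ (empty product $=1$). *)

(* Defs.v *)
From HB Require Import structures.
From mathcomp Require Import all_boot all_order all_algebra all_fingroup.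
From mathcomp Require Import all_classical all_reals all_analysis.
Set Implicit Arguments. Unset Strict Implicit. Unset Printing Implicit Defensive.
Import Order.TTheory GRing.Theory Num.Theory.
Local Open Scope classical_set_scope.
Local Open Scope ring_scope.

(* Double factorial with the paper's convention:
   m!! = (m-1)(m-3)..., product of positive integers <= m-1 of parity of m-1;
   empty product = 1.  So 0!! = 1!! = 1, (m+2)!! = (m+1) * m!!. *)
Fixpoint dfact (m : nat) : nat :=
  match m with
  | 0 => 1
  | 1 => 1
  | S (S k as k1) => (k1 * dfact k)%N
  end.

Section Haar.
Variable R : realType.
Variable n : nat.

(* n x n real matrices, encoded as n-tuples of rows, with the product
   (tuple) sigma-algebra of the Borel sigma-algebra on R. *)
Definition Mx : measurableType (measure_tuple_display (measure_tuple_display default_measure_display))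
  := n.-tuple (n.-tuple R).

Definition toM (x : Mx) : 'M[R]_n := \matrix_(i, j) tnth (tnth x i) j.
Definition fromM (A : 'M[R]_n) : Mx := [tuple [tuple A i j | j < n] | i < n].

Definition On : set Mx := [set x | toM x *m (toM x)^T = 1%:M].

Definition is_Haar_On (mu : probability Mx R) : Prop :=
  mu On = 1%E /\
  forall Q : 'M[R]_n, Q *m Q^T = 1%:M ->
    forall A : set Mx, measurable A ->
      mu ((fun x => fromM (Q *m toM x)) @^-1` A) = mu A.

(* entry u_{ij} with 1-based indices i, j (0 if out of range) *)
Definition entry (x : Mx) (i j : nat) : R :=
  nth 0 (tval (nth [tuple of nseq n 0] (tval x) i.-1)) j.-1.

Definition In_mom (mu : probability Mx R) (a b c d : nat) : R :=
  Rintegral mu setT (fun x => entry x 1 1 ^+ a * entry x 1 2 ^+ c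
                              * entry x 2 1 ^+ b * entry x 2 2 ^+ d).

Definition f_mom (mu : probability Mx R) (a b c d : nat) : R :=
  In_mom mu a b c d
  / ((dfact (a + d + n - 2))%:R * (dfact (b + c + n - 2))%:R).

Definition f4 (mu : probability Mx R) (w : 'I_4 -> nat) : R :=
  f_mom mu (w (inord 0)) (w (inord 1)) (w (inord 2)) (w (inord 3)).

End Haar.

(* Main.v *)
Require Import Defs.
From HB Require Import structures.
From mathcomp Require Import all_boot all_order all_algebra all_fingroup.
From mathcomp Require Import all_classical all_reals all_analysis.
From mathcomp Require Import measurable_realfun.
From mathcomp Require Import ring lra zify.
Set Implicit Arguments. Unset Strict Implicit. Unset Printing Implicit Defensive.
Import Order.TTheory GRing.Theory Num.Theory.
Local Open Scope classical_set_scope.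
Local Open Scope ring_scope.

(** Write I(a,b,c,d) for the moment of u11^a u21^b u12^c u22^d.  Left invariance
    under infinitesimal rotations of two rows makes the mean of every row-rotation
    derivative vanish.  Applied to monomials this gives a relation between moments
    of equal degree; applied to u_(l1) * monomial, summed over l <> 1 and combined
    with the orthonormality of the columns, it gives
      k I(k-1,b,c,d) = (k+b+c+n-1) I(k+1,b,c,d) + d I(k,b+1,c+1,d-1)
    and its images under exchanging the rows or the columns.  Eliminating the
    moments with odd exponents yields, after normalization, relations of the form
      (a+1)(a+2) f(a,b+2) - (b+1)(b+2) f(a+2,b)
        = (a-b)(a+b+n+1)(a+b+c+d+n+2) f(a+2,b+2)
    for the pair of arguments (a,b), and likewise for (c,d) and (a,d).  They are
    antisymmetric in the pair; when one argument of the pair is 0, raising the other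
    by 2 multiplies f by a factor that does not depend on which of the two is 0.
    Induction on the degree then shows that f is invariant under the transpositions
    (ab), (cd), (ad), which generate all permutations. *)

(** * Relations between moments *)

(* Unless a = b, where the claim is trivial, the first hypothesis determines
   G (a+2) (b+2) from values of lower degree. *)
Lemma exchange_sym (R : realFieldType) (m s : nat) (G : nat -> nat -> R) :
  (forall a b, (a.+1 * a.+2)%:R * G a b.+2 - (b.+1 * b.+2)%:R * G a.+2 b
    = (a%:R - b%:R) * ((a + b + m + 3) * (a + b + s + m + 4))%:R
      * G a.+2 b.+2) ->
  (forall a, a.+1%:R * G a 0 = ((a + s + m + 2) * (a + m).+1)%:R * G a.+2 0) ->
  (forall b, b.+1%:R * G 0 b = ((b + s + m + 2) * (b + m).+1)%:R * G 0 b.+2) ->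
  forall x y, G x.*2 y.*2 = G y.*2 x.*2.
Proof.
move=> exch lower upper.
have nz k : k.+1%:R != 0 :> R by rewrite pnatr_eq0.
have sym0 x : G x.*2 0 = G 0 x.*2.
  elim: x => [//|x IH]; rewrite doubleS.
  have [k Ek] : exists k, ((x.*2 + s + m + 2) * (x.*2 + m).+1 = k.+1)%N.
    by exists ((x.*2 + s + m + 2) * (x.*2 + m).+1).-1; rewrite prednK// muln_gt0 addn2.
  by apply: (mulfI (nz k)); rewrite -Ek -lower -upper IH.
suff sym N x y : (x + y < N)%N -> G x.*2 y.*2 = G y.*2 x.*2.
  by move=> x y; apply: (sym (x + y).+1).
elim: N x y => // N IH [|x] [|y] // ltN; rewrite ?doubleS -?sym0 ?doubleS //.
have [-> //|neq_xy] := eqVneq x y.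
have neq : x.*2%:R - y.*2%:R != 0 :> R.
  by rewrite subr_eq0 eqr_nat -!muln2 eqn_pmul2r.
(* After the induction hypothesis is applied, [e1] and [e2] have opposite left sides and opposite
   difference factors, so the remaining factors agree. *)
have e1 := exch x.*2 y.*2; have e2 := exch y.*2 x.*2.
have i1 := IH x y.+1; have i2 := IH x.+1 y; rewrite !doubleS in i1 i2.
rewrite i1 in e1; last by lia.
rewrite i2 in e1; last by lia.
have [k Ek] : exists k, ((x.*2 + y.*2 + m + 3) * (x.*2 + y.*2 + s + m + 4) = k.+1)%N.
  by eexists; rewrite addn3 addn4 mulSn addSn; reflexivity.
rewrite [in X in _ = _ * X * _](addnC y.*2) Ek in e2; rewrite Ek in e1.
apply: (mulfI (mulf_neq0 neq (nz k))).
by rewrite -e1 -[_ - y.*2%:R]opprB !mulNr -e2 opprB.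
Qed.

(* The arguments of J are the exponents of a matrix entry, of the other entry in
   its column, of the other entry in its row, and of the opposite entry; n = m.+2.
   The truncated predecessors at 0 only occur with coefficient 0. *)
Definition raise_law (R : realFieldType) (m : nat)
    (J : nat -> nat -> nat -> nat -> R) := forall k b c d : nat,
  k%:R * J k.-1 b c d
  = (k + b + c + m.+1)%:R * J k.+1 b c d + d%:R * J k b.+1 c.+1 d.-1.

Section ColumnRelations.
Variables (R : realFieldType) (m : nat) (I : nat -> nat -> nat -> nat -> R).
Hypothesis Ra : raise_law m I.
Hypothesis Rb : raise_law m (fun b a d c => I a b c d).
Hypothesis Rot : forall a b c d : nat,
  a%:R * I a.-1 b.+1 c d + c%:R * I a b c.-1 d.+1
  = b%:R * I a.+1 b.-1 c d + d%:R * I a b c.+1 d.-1.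

(* [Rot] relates moments of degree two less; each of them is expressed through
   moments of the present degree by [Ra] or [Rb]. *)
Lemma three_term (a b c d : nat) :
  (c * (b + 2) * (b + c + m.+1))%:R * I a.+3 b.+1 c.-1 d.+1
  = d%:R * (a + 2)%:R * (a + d + m.+1)%:R * I a.+1 b.+3 c.+1 d.-1
  - ((a + 2)%:R * (b + 2)%:R * (c%:R - d%:R) + c%:R * (b + 2)%:R * (d + 1)%:R
     - d%:R * (a + 2)%:R * (c + 1)%:R) * I a.+2 b.+2 c d.
Proof.
have h1 := congr1 ( *%R ((a + 2)%:R * (b + 2)%:R)) (Ra a.+1 b.+2 c d).
have h2 := congr1 ( *%R ((a + 2)%:R * (b + 2)%:R)) (Rb b.+1 a.+2 d c).
have h3 := congr1 ( *%R (c%:R * (b + 2)%:R)) (Ra a.+2 b.+1 c.-1 d.+1).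
have h4 := congr1 ( *%R (d%:R * (a + 2)%:R)) (Rb b.+2 a.+1 d.-1 c.+1).
have h5 := congr1 ( *%R ((a + 2)%:R * (b + 2)%:R)) (Rot a.+1 b.+1 c d).
rewrite /= in h1 h2 h3 h4 h5.
by case: c d h1 h2 h3 h4 h5 => [|c] [|d] /= h1 h2 h3 h4 h5; lra.
Qed.

(** The multipliers of [Ra] and [Rb] make the two moments with shifted [c] and [d] appear in exactly
    the combination that [three_term] evaluates. *)
Lemma column_exchange (a b c d : nat) :
  (a.+1 * a.+2 * (a + d + m.+1))%:R * I a b.+2 c d
  - (b.+1 * b.+2 * (b + c + m.+1))%:R * I a.+2 b c d
  = (a%:R - b%:R) * ((a + b + m + 3) * (a + b + (c + d) + m + 4))%:R
    * I a.+2 b.+2 c d.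
Proof.
have h1 := congr1 ( *%R (a.+2 * (a + d + m.+1))%:R) (Ra a.+1 b.+2 c d).
have h2 := congr1 ( *%R (b.+2 * (b + c + m.+1))%:R) (Rb b.+1 a.+2 d c).
have h3 := three_term a b c d.
rewrite /= in h1 h2; lra.
Qed.

(** At exponent 0 the left side of [Ra] vanishes, so [Ra] expresses the odd moment left over by [Rb]
    through [I 0 b.+2 c d]. *)
Lemma column_raise (b c d : nat) :
  (b.+1 * (b + c + m.+1))%:R * I 0 b c d
  = ((b + (c + d) + m + 2) * (b + m).+1)%:R * I 0 b.+2 c d.
Proof.
have h1 := congr1 ( *%R (b + c + m.+1)%:R) (Rb b.+1 0 d c).
have h2 := congr1 ( *%R c%:R) (Ra 0 b.+1 c.-1 d.+1).
by case: c h1 h2 => [|c] /= h1 h2; lra.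
Qed.

End ColumnRelations.

Section DiagonalRelations.
Variables (R : realFieldType) (m : nat) (I : nat -> nat -> nat -> nat -> R).
Hypothesis Ra : raise_law m I.
Hypothesis Rd : raise_law m (fun d c b a => I a b c d).

(** Both raising laws produce the same mixed moment [I a.+1 b.+1 c.+1 d.+1]; the multipliers make it
    cancel. *)
Lemma diagonal_exchange (a b c d : nat) :
  (a.+1 * a.+2)%:R * I a b c d.+2 - (d.+1 * d.+2)%:R * I a.+2 b c d
  = (a%:R - d%:R) * (a + d + (b + c) + m + 4)%:R * I a.+2 b c d.+2.
Proof.
have h1 := congr1 ( *%R a.+2%:R) (Ra a.+1 b c d.+2).
have h2 := congr1 ( *%R d.+2%:R) (Rd d.+1 c b a.+2).
rewrite /= in h1 h2; lra.
Qed.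

Lemma diagonal_raise (a b c : nat) :
  a.+1%:R * I a b c 0 = (a + (b + c) + m + 2)%:R * I a.+2 b c 0.
Proof. have := Ra a.+1 b c 0; rewrite /=; lra. Qed.

End DiagonalRelations.

Lemma dfact_gt0 k : (0 < dfact k)%N.
Proof.
suff [] : (0 < dfact k)%N /\ (0 < dfact k.+1)%N by [].
by elim: k => [//|k [IH1 IH2]]; split=> //; rewrite /= muln_gt0.
Qed.

(* For n = m.+2 and the moments I, this is f. *)
Definition normalized (R : realFieldType) (m : nat)
    (I : nat -> nat -> nat -> nat -> R) (a b c d : nat) : R :=
  I a b c d / ((dfact (a + d + m))%:R * (dfact (b + c + m))%:R).

(** * Symmetry after division by the double factorials *)

Section Normalized.
Variables (R : realFieldType) (m : nat) (I : nat -> nat -> nat -> nat -> R).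
Hypothesis Ra : raise_law m I.

Let dfact2 k : (dfact k.+2)%:R = k.+1%:R * (dfact k)%:R :> R.
Proof. by rewrite -natrM. Qed.

Let dfactN0 k : (dfact k)%:R != 0 :> R.
Proof. by rewrite pnatr_eq0 -lt0n dfact_gt0. Qed.

Let nz k : k.+1%:R != 0 :> R.
Proof. by rewrite pnatr_eq0. Qed.

Let cancel_fraction (p k x y : R) : p != 0 -> k * (x / y) = k * p * x / (p * y).
Proof. by move=> p0; rewrite invfM [k * p * x]mulrAC -!mulrA mulVKf. Qed.

(** Raising a by 2 multiplies (a+d+m)!! by a+d+m+1, and raising b by 2 multiplies (b+c+m)!! by
    b+c+m+1. The normalization absorbs these factors of [column_exchange] and [column_raise]; the
    remaining coefficients involve c and d only through c+d. *)
Lemma normalized_column_sym (c d x y : nat) :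
  raise_law m (fun b a d c => I a b c d) ->
  (forall a b c d, a%:R * I a.-1 b.+1 c d + c%:R * I a b c.-1 d.+1
     = b%:R * I a.+1 b.-1 c d + d%:R * I a b c.+1 d.-1) ->
  normalized m I x.*2 y.*2 c d = normalized m I y.*2 x.*2 c d.
Proof.
move=> Rb Rot.
apply: (@exchange_sym _ m (c + d) (fun a b => normalized m I a b c d)) => [a b|a|b];
  rewrite /normalized !addSn !dfact2 ?add0n.
- have := column_exchange Ra Rb Rot a b c d; rewrite !addnS.
  move=> E; set K := (a%:R - b%:R) * _ in E *.
  rewrite (cancel_fraction _ _ _ (nz (a + d + m))).
  rewrite (cancel_fraction _ _ (_ * _ * _) (nz (b + c + m))).
  rewrite (mulrCA (b + c + m).+1%:R (_ * _)) (mulrA (a + d + m).+1%:R).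
  by rewrite -mulrBl -!natrM E -(mulrA K).
(* Exchanging the rows moves the vanishing exponent from a to b. *)
- have := @column_raise _ m (fun a b c d => I b a d c) Rb Ra a d c.
  rewrite !addnS (addnC d) => E.
  by rewrite (cancel_fraction _ _ _ (nz (a + d + m))) -natrM E -!mulrA.
- have := column_raise Ra Rb b c d; rewrite !addnS => E.
  rewrite (cancel_fraction _ _ _ (nz (b + c + m))) -natrM E.
  by rewrite -!mulrA [in LHS](mulrCA _.+1%:R (dfact _)%:R).
Qed.

(** Both arguments of the pair enter the same double factorial. Its growth from (a+d+m+2)!! to
    (a+d+m+4)!! supplies the factor a+d+m+3 that [exchange_sym] expects and [diagonal_exchange]
    lacks. *)
Lemma normalized_diagonal_sym (b c x y : nat) :
  raise_law m (fun d c b a => I a b c d) ->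
  normalized m I x.*2 b c y.*2 = normalized m I y.*2 b c x.*2.
Proof.
move=> Rd.
apply: (@exchange_sym _ m (b + c) (fun a d => normalized m I a b c d)) => [a d|a|d];
  rewrite /normalized ?(addSn, addnS) !dfact2 ?add0n ?addn0.
- have := diagonal_exchange Ra Rd a b c d; rewrite !addnS => E.
  rewrite !(mulrA _%:R (I _ _ _ _)) -mulrBl E -(mulrA (a + d + m).+3%:R).
  rewrite natrM (mulrCA (_ - _)) (mulrC (a + d + m).+3%:R) (mulrA (_ * _.+3%:R)).
  by rewrite -(cancel_fraction _ _ _ (nz (a + d + m).+2)) mulrA addn0.
- have := diagonal_raise Ra a b c; rewrite !addnS !addn0 => E.
  rewrite mulrA E natrM -(mulrA (a + m).+1%:R) (mulrA (_ * _)).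
  by rewrite -(cancel_fraction _ _ _ (nz (a + m))) mulrA.
- have := @diagonal_raise _ m (fun a b c d => I d c b a) Rd d c b.
  rewrite !addnS !addn0 (addnC c) => E.
  rewrite mulrA E natrM -(mulrA (d + m).+1%:R) (mulrA (_ * _)).
  by rewrite -(cancel_fraction _ _ _ (nz (d + m))) mulrA.
Qed.
End Normalized.

(** * Means over the orthogonal group *)

Section Measurability.
Variables (R : realType) (n : nat).
Implicit Types (i j : 'I_n).

Lemma measurable_coord i j : measurable_fun setT (fun x : Mx R n => toM x i j).
Proof.
rewrite (_ : (fun x => _) = (tnth (T := R))^~ j \o (tnth (T := n.-tuple R))^~ i).
  apply: measurableT_comp; exact: measurable_tnth.
by apply/funext => x; rewrite /toM mxE.
Qed.

Lemma toM_fromM (A : 'M[R]_n) : toM (fromM A) = A.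
Proof. by apply/matrixP => i j; rewrite mxE !tnth_mktuple. Qed.

Lemma measurable_mulmx (Q : 'M[R]_n) :
  measurable_fun setT (fun x : Mx R n => fromM (Q *m toM x)).
Proof.
apply/measurable_fun_tnthP => i; apply/measurable_fun_tnthP => j.
rewrite (_ : _ \o _ = fun x => \sum_k Q i k * toM x k j).
  apply: measurable_sum => k; apply: measurable_funM => //; exact: measurable_coord.
by apply/funext => x; rewrite /= !tnth_mktuple mxE.
Qed.

Lemma measurable_On : measurable (@On R n).
Proof.
rewrite (_ : @On R n =
  \bigcap_(i in [set: 'I_n]) \bigcap_(j in [set: 'I_n])
    ((fun x => (toM x *m (toM x)^T) i j == (1%:M : 'M[R]_n) i j) @^-1` [set true])).
  apply: fin_bigcap_measurable => // i _.
  apply: fin_bigcap_measurable => // j _.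
  rewrite -[_ @^-1` _]setTI; apply: measurable_fun_eqr => //.
  rewrite (_ : (fun x => _) = fun x => \sum_k toM x i k * toM x j k).
    by apply: measurable_sum => k; apply: measurable_funM; exact: measurable_coord.
  by apply/funext => x; rewrite mxE; apply: eq_bigr => k _; rewrite [(_^T)%R _ _]mxE.
apply/seteqP; split=> x /=.
  by move=> xO i _ j _ ; apply/eqP; rewrite xO.
by move=> xO; apply/matrixP => i j; apply/eqP/(xO i _ j).
Qed.

Lemma On_row_orthonormal (x : Mx R n) (p q : 'I_n) : On x ->
  \sum_k toM x p k * toM x q k = (p == q)%:R.
Proof.
move=> /(congr1 (fun A : 'M[R]_n => A p q)); rewrite !mxE => <-.
by apply: eq_bigr => k _; rewrite [(_^T)%R _ _]mxE.
Qed.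

Lemma On_col_orthonormal (x : Mx R n) (p q : 'I_n) : On x ->
  \sum_k toM x k p * toM x k q = (p == q)%:R.
Proof.
move=> /mulmx1C /(congr1 (fun A : 'M[R]_n => A p q)); rewrite !mxE => <-.
by apply: eq_bigr => k _; rewrite [(_^T)%R _ _]mxE.
Qed.

Lemma On_entry_le1 (x : Mx R n) (p q : 'I_n) : On x -> `|toM x p q| <= 1.
Proof.
move=> xO; have := On_row_orthonormal p p xO; rewrite eqxx mulr1n (bigD1 q)//= => E.
rewrite -(@ler_pXn2r _ 2) ?nnegrE// expr1n real_normK ?num_real// -E expr2 lerDl.
by apply: sumr_ge0 => k _; rewrite -expr2 sqr_ge0.
Qed.
End Measurability.

(** * Rotations in the plane of two rows *)

Section Rotation.
Variables (R : realType) (n : nat).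
Implicit Types (s c : R) (i k : 'I_n).

(* s is the sine of the angle; only s ^+ 2 <= 1 is meaningful. *)
Definition rotation i k s : 'M[R]_n :=
  let c := Num.sqrt (1 - s ^+ 2) in
  \matrix_(p, q) (if p == i then c *+ (q == i) + s *+ (q == k)
    else if p == k then c *+ (q == k) - s *+ (q == i) else (p == q)%:R).

Lemma rotationE i k s (A : 'M[R]_n) p j : i != k ->
  (rotation i k s *m A) p j =
    let c := Num.sqrt (1 - s ^+ 2) in
    if p == i then c * A i j + s * A k j
    else if p == k then c * A k j - s * A i j else A p j.
Proof.
move=> ik; rewrite mxE /=.
have sel q0 : \sum_q (q == q0)%:R * A q j = A q0 j.
  rewrite (bigD1 q0)//= eqxx mul1r big1 ?addr0// => q /negPf ->; exact: mul0r.
under eq_bigr do rewrite mxE.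
case: ifP => _; [|case: ifP => _].
- under eq_bigr do rewrite mulrDl -mulr_natr -[s *+ _]mulr_natr -!mulrA.
  by rewrite big_split -!mulr_sumr !sel.
- under eq_bigr do rewrite mulrBl -mulr_natr -[s *+ _]mulr_natr -!mulrA.
  by rewrite sumrB -!mulr_sumr !sel.
- under eq_bigr do rewrite eq_sym.
  exact: sel.
Qed.

Lemma rotation_orthogonal i k s : i != k -> s ^+ 2 <= 1 ->
  rotation i k s *m (rotation i k s)^T = 1%:M.
Proof.
move=> ik s1; apply/matrixP => p q; rewrite rotationE// !mxE /=.
have c2 : Num.sqrt (1 - s ^+ 2) ^+ 2 = 1 - s ^+ 2 by rewrite sqr_sqrtr ?subr_ge0.
set c := Num.sqrt _ in c2 *.
have ki : k == i = false by rewrite eq_sym; apply/negbTE.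
case: (eqVneq p i) => [?|pi]; [|case: (eqVneq p k) => [?|pk]];
  (case: (eqVneq q i) => [?|qi]; [|case: (eqVneq q k) => [?|qk]]);
  subst; rewrite ?eqxx ?ki ?(negPf ik) ?(negPf pi) ?(negPf pk) ?mulr1n ?mulr0n
    ?(eq_sym i q) ?(eq_sym k q) ?(negPf qi) ?(negPf qk) ?mulr0n.
all: try ring: c2.
all: rewrite ?addr0 ?add0r ?subr0 ?sub0r ?mulr0 ?mulrN ?subr0 ?addr0//.
all: try ring: c2.
by rewrite eq_sym.
Qed.

Definition rotate i k s (x : Mx R n) : Mx R n := fromM (rotation i k s *m toM x).

Lemma rotate_On i k s x : i != k -> s ^+ 2 <= 1 -> On (rotate i k s x) <-> On x.
Proof.
move=> ik s1; rewrite /On /= /rotate toM_fromM trmx_mul -mulmxA.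
have QQ := rotation_orthogonal ik s1.
split=> [E|E].
  have := congr1 (mulmx (rotation i k s)^T \o (mulmx^~ (rotation i k s))) E.
  by rewrite /= mul1mx -!mulmxA (mulmx1C QQ) mulmx1 mulmxA (mulmx1C QQ) mul1mx.
by rewrite (mulmxA (toM x)) E mul1mx QQ.
Qed.
End Rotation.

(** * Bounded functions and the invariance of their means *)

Section Mean.
Variables (R : realType) (n : nat) (mu : probability (Mx R n) R).
Hypothesis haar : is_Haar_On mu.
Local Notation T := (Mx R n).
Implicit Types (i k : 'I_n) (h g : T -> R).

(** The bound is asked for on [On] only, since polynomials in the entries are unbounded on the whole
    matrix space. *)
Definition bounded_On h :=
  measurable_fun setT h /\ exists C, forall x, On x -> `|h x| <= C.

Definition mean h : R := Rintegral mu (@On R n) h.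

Let mOn := @measurable_On R n.

Lemma bounded_On_integrable h : bounded_On h -> mu.-integrable (@On R n) (EFin \o h).
Proof.
move=> [mh [C hC]]; apply: measurable_bounded_integrable => //.
- by rewrite (le_lt_trans (probability_le1 _ _))// ltry.
- exact: measurable_funTS.
- exists C; split; first exact: num_real.
  by move=> M CM x Ox; exact: le_trans (hC x Ox) (ltW CM).
Qed.

Lemma bounded_On_cst (c : R) : bounded_On (cst c).
Proof. by split=> //; exists `|c| => x _. Qed.

Lemma bounded_OnD h g : bounded_On h -> bounded_On g ->
  bounded_On (fun x => h x + g x).
Proof.
move=> [mh [C hC]] [mg [D gD]]; split; first exact: measurable_funD.
by exists (C + D) => x Ox; rewrite (le_trans (ler_normD _ _)) ?lerD ?hC ?gD.
Qed.

Lemma bounded_OnM h g : bounded_On h -> bounded_On g ->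
  bounded_On (fun x => h x * g x).
Proof.
move=> [mh [C hC]] [mg [D gD]]; split; first exact: measurable_funM.
by exists (C * D) => x Ox; rewrite normrM ler_pM ?hC ?gD.
Qed.

Lemma bounded_OnZ (c : R) h : bounded_On h -> bounded_On (fun x => c * h x).
Proof. by apply: bounded_OnM; exact: bounded_On_cst. Qed.

Lemma bounded_OnN h : bounded_On h -> bounded_On (fun x => - h x).
Proof.
move=> bh; rewrite (_ : (fun x => _) = fun x => cst (-1) x * h x).
  by apply: bounded_OnM => //; exact: bounded_On_cst.
by apply/funext => x; rewrite mulN1r.
Qed.

Lemma bounded_OnX h m : bounded_On h -> bounded_On (fun x => h x ^+ m).
Proof.
move=> bh; elim: m => [|m IH]; first exact: bounded_On_cst.
rewrite (_ : (fun x => _) = fun x => h x * h x ^+ m); first exact: bounded_OnM.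
by apply/funext => x; rewrite exprS.
Qed.

Lemma bounded_On_coord i j : bounded_On (fun x => toM x i j).
Proof.
split; first exact: measurable_coord.
by exists 1 => x Ox; exact: On_entry_le1.
Qed.

Lemma bounded_On_sum (J : Type) (r : seq J) (P : pred J) (F : J -> T -> R) :
  (forall l, bounded_On (F l)) ->
  bounded_On (fun x => \sum_(l <- r | P l) F l x).
Proof.
move=> bF; elim: r => [|l r IH].
  rewrite (_ : (fun x => _) = cst 0); first exact: bounded_On_cst.
  by apply/funext => x; rewrite big_nil.
case Pl : (P l); last first.
  by rewrite (_ : (fun x => _) = fun x => \sum_(l <- r | P l) F l x)//;
    apply/funext => x; rewrite big_cons Pl.
rewrite (_ : (fun x => _) = fun x => F l x + \sum_(l <- r | P l) F l x).
  exact: bounded_OnD.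
by apply/funext => x; rewrite big_cons Pl.
Qed.

Lemma eq_mean h g : (forall x, On x -> h x = g x) -> mean h = mean g.
Proof. by move=> hg; apply: eq_Rintegral => x; rewrite inE => /hg. Qed.

Lemma meanD h g : bounded_On h -> bounded_On g ->
  mean (fun x => h x + g x) = mean h + mean g.
Proof. by move=> bh bg; apply: RintegralD => //; exact: bounded_On_integrable. Qed.

Lemma meanZ c h : bounded_On h -> mean (fun x => c * h x) = c * mean h.
Proof. by move=> bh; apply: RintegralZl => //; exact: bounded_On_integrable. Qed.

Lemma mean0 : mean (fun=> 0) = 0.
Proof. by rewrite /mean Rintegral_cst// mul0r. Qed.

Lemma mean_sum (J : Type) (r : seq J) (P : pred J) (F : J -> T -> R) :
  (forall l, bounded_On (F l)) ->
  mean (fun x => \sum_(l <- r | P l) F l x) = \sum_(l <- r | P l) mean (F l).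
Proof.
move=> bF; elim: r => [|l r IH].
  by rewrite big_nil -[RHS]mean0; apply: eq_mean => x _; rewrite big_nil.
rewrite big_cons; case: ifP => Pl; rewrite -IH.
  rewrite -meanD//; last exact: bounded_On_sum.
  by apply: eq_mean => x _; rewrite big_cons Pl.
by apply: eq_mean => x _; rewrite big_cons Pl.
Qed.

Lemma le_norm_mean h C : bounded_On h ->
  (forall x, On x -> `|h x| <= C) -> `|mean h| <= C.
Proof.
move=> bh hC; apply: le_trans (le_normr_Rintegral _ _) _ => //.
  exact: bounded_On_integrable.
(* This uses that [On] has mass 1. *)
have -> : C = mean (cst C).
  rewrite /mean Rintegral_cst//.
  by rewrite -[LHS]mulr1; congr (_ * _); exact: esym (congr1 fine haar.1).
apply: le_Rintegral => //.
- apply: (@bounded_On_integrable (fun x => `|h x|)); case: bh => mh [D hD]; split.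
    exact: measurableT_comp.
  by exists D => x Ox; rewrite normr_id hD.
- by apply: bounded_On_integrable; exact: bounded_On_cst.
Qed.

(** Change of variables: by left invariance the pushforward of [mu] under the rotation is [mu]
    again, and the preimage of [On] is [On]. *)
Lemma mean_rotate i k (s : R) h : i != k -> s ^+ 2 <= 1 -> bounded_On h ->
  bounded_On (h \o rotate i k s) /\ mean (h \o rotate i k s) = mean h.
Proof.
move=> ik s1 bh; have [mh [C hC]] := bh.
have mrot : measurable_fun setT (rotate (R := R) i k s) := @measurable_mulmx _ _ _.
have bhr : bounded_On (h \o rotate i k s).
  split; first exact: measurableT_comp.
  by exists C => x Ox; apply: hC; apply/rotate_On.
split=> //; rewrite /mean /Rintegral; congr fine.
have preOn : rotate i k s @^-1` (@On R n) = @On R n.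
  by apply/seteqP; split=> x /(rotate_On _ ik s1).
transitivity
  (\int[pushforward mu (rotate (R := R) i k s)]_(x in @On R n) (EFin \o h) x)%E.
  rewrite (@integral_pushforward _ _ _ _ _ _ mrot)//; first by rewrite preOn.
    exact/measurable_EFinP.
  by rewrite preOn; exact: bounded_On_integrable.
apply: eq_measure_integral => A mA _.
have [_ inv] := haar; exact: (inv _ (rotation_orthogonal ik s1)).
Qed.

End Mean.

(** * Infinitesimal rotations *)

Section Tangent.
Variables (R : realType) (n : nat) (mu : probability (Mx R n) R).
Hypothesis haar : is_Haar_On mu.
Local Notation T := (Mx R n).
Implicit Types (i k l : 'I_n) (h g : T -> R).

(* h' is the derivative of h along the rotations of the rows i and k; the uniform
   quadratic remainder replaces differentiation under the integral sign. *)
Definition tangent i k h h' := [/\ bounded_On h, bounded_On h' &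
  exists C, forall x s, On x -> 0 <= s <= 1 ->
    `|h (rotate i k s x) - h x - s * h' x| <= C * s ^+ 2].

Lemma bound_ge0 h : bounded_On h ->
  exists C, 0 <= C /\ forall x, On x -> `|h x| <= C.
Proof.
move=> [_ [C hC]]; exists `|C|; split=> // x Ox.
exact: le_trans (hC x Ox) (ler_norm C).
Qed.

Let sqr_le1 (s : R) : 0 <= s <= 1 -> s ^+ 2 <= 1.
Proof. by move=> /andP[s0 s1]; rewrite exprn_ile1. Qed.

Lemma tangentM i k h h' g g' : i != k -> tangent i k h h' -> tangent i k g g' ->
  tangent i k (fun x => h x * g x) (fun x => h' x * g x + h x * g' x).
Proof.
move=> ik [bh bh' [C hC]] [bg bg' [D gD]].
split; [exact: bounded_OnM| by apply: bounded_OnD; exact: bounded_OnM|].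
have [H [H0 hH]] := bound_ge0 bh; have [H' [H'0 hH']] := bound_ge0 bh'.
have [G [G0 gG]] := bound_ge0 bg; have [G' [G'0 gG']] := bound_ge0 bg'.
(* With e, e' the remainders of h, g and y the rotated point, the remainder of the product is s^2 h'
   g' + e g(y) + (h + s h') e'. The three summands bound these terms, using s <= 1 in the last. *)
exists (H' * G' + C * G + (H + H') * D) => x s Ox s01.
set y := rotate i k s x.
have Oy : On y by apply/rotate_On => //; exact: sqr_le1.
have := hC x s Ox s01; have := gD x s Ox s01; rewrite -/y.
set e := h y - _ - _; set e' := g y - _ - _ => le' le.
rewrite (_ : _ - _ = s ^+ 2 * (h' x * g' x) + e * g y + (h x + s * h' x) * e');
  last by rewrite /e /e'; ring.
have /andP[s0 s1] := s01.
rewrite [leRHS](_ : _ = s ^+ 2 * (H' * G') + C * s ^+ 2 * G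
  + (H + H') * (D * s ^+ 2)); last by ring.
apply: le_trans (ler_normD _ _) _; apply: lerD.
  apply: le_trans (ler_normD _ _) _; apply: lerD; rewrite normrM ler_pM ?gG//.
    by rewrite ger0_norm ?sqr_ge0.
  by rewrite normrM ler_pM ?hH' ?gG'.
rewrite normrM ler_pM//; apply: le_trans (ler_normD _ _) _.
rewrite lerD ?hH// normrM ger0_norm//.
by rewrite -[leRHS]mul1r ler_pM ?hH'.
Qed.

Lemma tangent_ext i k h g h' g' : (forall x, h x = g x) -> (forall x, h' x = g' x) ->
  tangent i k h h' -> tangent i k g g'.
Proof. by move=> /funext -> /funext ->. Qed.

Lemma tangent_cst i k c : tangent i k (cst c) (cst 0).
Proof.
split; [exact: bounded_On_cst|exact: bounded_On_cst|].
by exists 0 => x s _ _; rewrite /= subrr mulr0 subr0 normr0 mul0r.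
Qed.

Lemma tangentX i k h h' m : i != k -> tangent i k h h' ->
  tangent i k (fun x => h x ^+ m) (fun x => m%:R * h x ^+ m.-1 * h' x).
Proof.
move=> ik th; elim: m => [|m IH].
  apply: tangent_ext (tangent_cst i k 1) => x /=; first by rewrite expr0.
  by rewrite !mul0r.
apply: tangent_ext (tangentM ik th IH) => x; first by rewrite exprS.
case: m {IH} => [|m] /=; first by rewrite expr0; ring.
by rewrite -[in RHS]natr1 exprS; ring.
Qed.

Lemma tangent_coord i k p j : i != k ->
  tangent i k (fun x => toM x p j)
    (fun x => (p == i)%:R * toM x k j - (p == k)%:R * toM x i j).
Proof.
move=> ik; split; first exact: bounded_On_coord.
  by apply: bounded_OnD; [|apply: bounded_OnN]; apply: bounded_OnM;
    (exact: bounded_On_coord || exact: bounded_On_cst).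
exists 1 => x s Ox s01; have s2 := sqr_le1 s01.
rewrite mul1r /rotate toM_fromM rotationE//=.
set c := Num.sqrt _.
have c2 : c ^+ 2 = 1 - s ^+ 2 by rewrite sqr_sqrtr ?subr_ge0.
have c0 : 0 <= c by exact: sqrtr_ge0.
have c1 : c <= 1 by rewrite -(@ler_pXn2r _ 2)// ?nnegrE// expr1n c2 gerBl sqr_ge0.
(* From 0 <= c <= 1 follows 1 - c <= 1 - c^2 = s^2, and entries are at most 1 in absolute value. The
   remainder of a moved entry is (c - 1) times that entry. *)
have cs q : `|(c - 1) * toM x q j| <= s ^+ 2.
  rewrite normrM -[leRHS]mulr1 ler_pM//; last exact: On_entry_le1.
  by rewrite ler0_norm ?subr_le0//; nra.
have [->|pi] := eqVneq p i.
  rewrite (negPf ik) mulr1n mulr0n; apply: le_trans (cs i).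
  by rewrite le_eqVlt; apply/predU1P; left; congr `|_|; ring.
have [->|pk] := eqVneq p k.
  rewrite mulr1n mulr0n; apply: le_trans (cs k).
  by rewrite le_eqVlt; apply/predU1P; left; congr `|_|; ring.
by rewrite mulr0n !mul0r subr0 mulr0 subr0 subrr normr0 sqr_ge0.
Qed.

(** Invariance cancels the means of h and of its rotate, leaving s |mean h'| <= C s^2 for every s in
    (0,1]; let s tend to 0. *)
Lemma mean_tangent i k h h' : i != k -> tangent i k h h' -> mean mu h' = 0.
Proof.
move=> ik [bh bh' [C hC]].
have small s : 0 < s <= 1 -> `|mean mu h'| <= C * s.
  move=> /andP[s0 s1]; have s01 : 0 <= s <= 1 by rewrite ltW.
  have [bhr hr] := mean_rotate haar ik (sqr_le1 s01) bh.
  rewrite -(ler_pM2l s0) mulrCA -expr2 -[s in leLHS]gtr0_norm// -normrM.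
  rewrite -normrN (_ : - _ = mean mu (fun x => h (rotate i k s x) - h x - s * h' x)).
    apply: (le_norm_mean haar) => [|x Ox]; last exact: hC.
    apply: bounded_OnD; first by apply: bounded_OnD => //; exact: bounded_OnN.
    by apply: bounded_OnN; apply: bounded_OnM => //; exact: bounded_On_cst.
  rewrite -[RHS](_ : mean mu (fun x => (h (rotate i k s x) + (-1) * h x)
    + (- s) * h' x) = _); last first.
    by apply: eq_mean => x _; rewrite mulN1r mulNr.
  rewrite !meanD//; try by [apply: bounded_OnD => //; exact: bounded_OnZ
    |exact: bounded_OnZ].
  by rewrite !meanZ// [mean mu (fun x => h (rotate i k s x))]hr mulN1r subrr add0r mulNr.
apply/eqP; rewrite -normr_le0 leNgt; apply/negP => E0.
have C0 : 0 < C.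
  have := small 1; rewrite ltr01 lexx mulr1 => /(_ isT); exact: lt_le_trans.
(* For this s, C s is at most half of |mean h'|, contradicting [small]. *)
pose s := Num.min 1 (`|mean mu h'| / C / 2).
have s0 : 0 < s by rewrite lt_min ltr01 !divr_gt0.
have := small s; rewrite s0 ge_min lexx => /(_ isT).
rewrite leNgt => /negP; apply.
have : s <= `|mean mu h'| / C / 2 by rewrite ge_min lexx orbT.
rewrite -(ler_pM2l C0) => /le_lt_trans; apply.
by rewrite mulrA mulrCA divff ?gt_eqF// mulr1; lra.
Qed.
End Tangent.

(** * Moments of a 2 by 2 block of entries *)

Section Moments.
Variables (R : realType) (m : nat) (mu : probability (Mx R m.+2) R).
Hypothesis haar : is_Haar_On mu.
Local Notation n := m.+2.
Local Notation T := (Mx R n).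

(** Rows and columns are arbitrary, so that a relation proved for the first exponent transfers to
    the others by exchanging [i1] with [i2] or [j1] with [j2]. *)
Definition monomial (i1 i2 j1 j2 : 'I_n) (a b c d : nat) (x : T) : R :=
  toM x i1 j1 ^+ a * toM x i2 j1 ^+ b * toM x i1 j2 ^+ c * toM x i2 j2 ^+ d.

Definition moment i1 i2 j1 j2 a b c d := mean mu (monomial i1 i2 j1 j2 a b c d).

Lemma bounded_monomial i1 i2 j1 j2 a b c d : bounded_On (monomial i1 i2 j1 j2 a b c d).
Proof.
by rewrite /monomial; do ![apply: bounded_OnM];
  apply: bounded_OnX; exact: bounded_On_coord.
Qed.

Lemma moment_swap_rows i1 i2 j1 j2 a b c d :
  moment i2 i1 j1 j2 b a d c = moment i1 i2 j1 j2 a b c d.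
Proof. by apply: eq_mean => x _; rewrite /monomial; ring. Qed.

Lemma moment_swap_cols i1 i2 j1 j2 a b c d :
  moment i1 i2 j2 j1 c d a b = moment i1 i2 j1 j2 a b c d.
Proof. by apply: eq_mean => x _; rewrite /monomial; ring. Qed.

Variables (i1 i2 j1 j2 : 'I_n).
Hypotheses (ineq : i1 != i2) (jneq : j1 != j2).
Local Notation mono := (monomial i1 i2 j1 j2).
Local Notation M := (moment i1 i2 j1 j2).

(** Row [i1] has derivative row [l]; row [i2] moves only when [l] is [i2], with derivative minus row
    [i1]. *)
Lemma tangent_monomial l a b c d : i1 != l -> tangent i1 l (mono a b c d)
  (fun x => a%:R * mono a.-1 b c d x * toM x l j1
          + c%:R * mono a b c.-1 d x * toM x l j2
          - (l == i2)%:R * (b%:R * mono a.+1 b.-1 c d x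
                            + d%:R * mono a b c.+1 d.-1 x)).
Proof.
move=> il.
have tX p j e := tangentX e il (tangent_coord R p j il).
apply: tangent_ext (tangentM il (tangentM il (tangentM il (tX i1 j1 a) (tX i2 j1 b))
  (tX i1 j2 c)) (tX i2 j2 d)) => x //.
rewrite /monomial eqxx (eq_sym i2) (negPf ineq) (negPf il) (eq_sym i2 l) mulr1n !mulr0n.
rewrite !(mul0r, subr0, mul1r, sub0r) !exprS.
by case: a => [|a]; case: c => [|c]; ring.
Qed.

Lemma moment_rotation a b c d :
  a%:R * M a.-1 b.+1 c d + c%:R * M a b c.-1 d.+1
  = b%:R * M a.+1 b.-1 c d + d%:R * M a b c.+1 d.-1.
Proof.
apply/eqP; rewrite -subr_eq0; apply/eqP.
rewrite -(mean_tangent haar ineq (tangent_monomial a b c d ineq)).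
have bm := bounded_monomial i1 i2 j1 j2.
rewrite -[RHS](_ : mean mu (fun x =>
  a%:R * mono a.-1 b.+1 c d x + c%:R * mono a b c.-1 d.+1 x
  + ((- b%:R) * mono a.+1 b.-1 c d x + (- d%:R) * mono a b c.+1 d.-1 x)) = _).
  rewrite !meanD ?meanZ; try by do ?[apply: bounded_OnD]; try exact: bounded_OnZ.
  by rewrite /moment; ring.
by apply: eq_mean => x _; rewrite eqxx mulr1n /monomial !exprS; ring.
Qed.

(* Sums, over the rows l distinct from i1, the vanishing means of the derivatives
   of toM x l j1 * mono k b c d; column orthonormality removes the other rows. *)
Lemma moment_raise : raise_law m M.
Proof.
move=> k b c d.
have bm := bounded_monomial i1 i2 j1 j2.
pose A x := k%:R * mono k.-1 b c d x.
pose B x := c%:R * mono k b c.-1 d x.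
pose C x := b%:R * mono k.+1 b.-1 c d x + d%:R * mono k b c.+1 d.-1 x.
(* The leading term comes from differentiating the extra factor [toM x l j1], the rest from
   [tangent_monomial]. *)
pose D l x := - (toM x i1 j1 * mono k b c d x) + (toM x l j1 * toM x l j1 * A x
  + toM x l j1 * toM x l j2 * B x - (l == i2)%:R * (toM x l j1 * C x)).
have bX := @bounded_On_coord R n.
have bA : bounded_On A by exact: bounded_OnZ.
have bB : bounded_On B by exact: bounded_OnZ.
have bC : bounded_On C by apply: bounded_OnD; exact: bounded_OnZ.
have bD l : bounded_On (D l).
  apply: bounded_OnD; first by apply: bounded_OnN; exact: bounded_OnM.
  apply: bounded_OnD; last by apply: bounded_OnN; apply: bounded_OnZ; exact: bounded_OnM.
  by apply: bounded_OnD; apply: bounded_OnM => //; exact: bounded_OnM.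
have D0 l : l != i1 -> mean mu (D l) = 0.
  rewrite eq_sym => il.
  apply: (mean_tangent haar il); apply: tangent_ext (tangentM il
    (tangent_coord R l j1 il) (tangent_monomial k b c d il)) => x //.
  by rewrite eqxx (eq_sym l i1) (negPf il) /D /A /B /C mulr1n mulr0n; ring.
have : mean mu (fun x => \sum_(l | l != i1) D l x) = 0.
  by rewrite mean_sum// big1.
(* The n - 1 = [m.+1] rows other than [i1] give the first coefficient. Column orthonormality
   evaluates the sums multiplying [A] and [B], and only the row [i2] contributes to [C]. *)
have sumD x : On x -> \sum_(l | l != i1) D l x =
  - (m.+1%:R * (toM x i1 j1 * mono k b c d x)) +
  ((1 - toM x i1 j1 ^+ 2) * A x - toM x i1 j1 * toM x i1 j2 * B x
  - toM x i2 j1 * C x).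
  move=> Ox; rewrite big_split/= sumr_const cardC1 card_ord; congr (_ + _).
    by rewrite mulNrn mulr_natl.
  rewrite sumrB big_split/= -!mulr_suml; congr (_ * _ + _ - _).
  - have := On_col_orthonormal j1 j1 Ox; rewrite (bigD1 i1)//= eqxx mulr1n => <-; ring.
  - have := On_col_orthonormal j1 j2 Ox; rewrite (bigD1 i1)//= (negPf jneq) mulr0n => E.
    by rewrite -mulNr; congr (_ * _); apply/eqP; rewrite -addr_eq0 addrC E.
  - rewrite (bigD1 i2) 1?eq_sym//= eqxx mul1r big1 ?addr0// => l /andP[_ /negPf ->].
    by rewrite mul0r.
rewrite (eq_mean mu sumD) => E.
apply/eqP; rewrite -subr_eq0; apply/eqP; rewrite -E.
rewrite -[RHS](_ : mean mu (fun x => k%:R * mono k.-1 b c d x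
  + ((- (k + b + c + m.+1)%:R) * mono k.+1 b c d x
  + (- d%:R) * mono k b.+1 c.+1 d.-1 x)) = _).
  rewrite !meanD ?meanZ; try by do ?[apply: bounded_OnD]; try exact: bounded_OnZ.
  by rewrite /moment; ring.
apply: eq_mean => x _; rewrite /A /B /C /monomial !natrD !exprS.
by case: k {E A B C D bA bB bC bD D0 sumD} => [|k]; case: c => [|c]; case: b => [|b];
  rewrite /= ?exprS; ring.
Qed.
End Moments.

(** * Symmetry of the normalized moments *)

Lemma entryE (R : realType) n (x : Mx R n) (i j : 'I_n) :
  entry x i.+1 j.+1 = toM x i j.
Proof. by rewrite mxE /entry /= (tnth_nth 0) (tnth_nth [tuple of nseq n 0]). Qed.

(** The complement of [On] is null. *)
Lemma Rintegral_On (R : realType) n (mu : probability (Mx R n) R) (h : Mx R n -> R) :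
  is_Haar_On mu -> measurable_fun setT h -> Rintegral mu setT h = mean mu h.
Proof.
move=> [muOn _] mh; rewrite /mean [RHS]Rintegral_mkcond /Rintegral; congr fine.
have mOn := @measurable_On R n.
apply: ae_eq_integral => //.
- exact/measurable_EFinP.
- by apply/measurable_EFinP/(measurable_restrictT _ mOn); exact: measurable_funTS.
exists (~` @On R n); split; first exact: measurableC.
  by apply: etrans (probability_setC mu mOn) _; rewrite muOn subee.
move=> x /=; apply: contra_not => Ox _; rewrite /= /patch mem_set//.
Qed.

Section BlockSymmetry.
Variables (R : realType) (m : nat) (mu : probability (Mx R m.+2) R).
Hypothesis haar : is_Haar_On mu.

Lemma moment_column_sym (i1 i2 j1 j2 : 'I_m.+2) (c d x y : nat) :
  i1 != i2 -> j1 != j2 ->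
  normalized m (moment mu i1 i2 j1 j2) x.*2 y.*2 c d
  = normalized m (moment mu i1 i2 j1 j2) y.*2 x.*2 c d.
Proof.
move=> i12 j12; apply: normalized_column_sym; first exact: moment_raise.
  move=> b a d' c'; rewrite -!(moment_swap_rows mu i1).
  by apply: (moment_raise haar) => //; rewrite eq_sym.
exact: moment_rotation.
Qed.

Lemma moment_diagonal_sym (i1 i2 j1 j2 : 'I_m.+2) (b c x y : nat) :
  i1 != i2 -> j1 != j2 ->
  normalized m (moment mu i1 i2 j1 j2) x.*2 b c y.*2
  = normalized m (moment mu i1 i2 j1 j2) y.*2 b c x.*2.
Proof.
move=> i12 j12; apply: normalized_diagonal_sym; first exact: moment_raise.
move=> d c' b' a; rewrite -!(moment_swap_rows mu i1) -!(moment_swap_cols mu i2 i1 j1).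
by apply: (moment_raise haar); rewrite eq_sym.
Qed.

Let j0 : 'I_m.+2 := ord0.
Let j1 : 'I_m.+2 := lift ord0 ord0.

Lemma f_momE a b c d :
  f_mom mu a b c d = normalized m (moment mu j0 j1 j0 j1) a b c d.
Proof.
rewrite /f_mom /normalized !addnS !subSS !subn0; congr (_ / _).
have E : (fun x : Mx R m.+2 => entry x 1 1 ^+ a * entry x 1 2 ^+ c
    * entry x 2 1 ^+ b * entry x 2 2 ^+ d) = monomial j0 j1 j0 j1 a b c d.
  by apply/funext => x; rewrite /monomial -!entryE; ring.
by rewrite /In_mom E Rintegral_On//; exact: (bounded_monomial R j0 j1 j0 j1 a b c d).1.
Qed.

(** Exchanging the columns also exchanges the two double factorials, so the symmetry in c and d
    becomes an instance of [moment_column_sym]. *)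
Lemma f_mom_swap_cols a b c d : f_mom mu a b c d
  = normalized m (moment mu j0 j1 j1 j0) c d a b.
Proof.
rewrite f_momE /normalized moment_swap_cols; congr (_ / _).
by rewrite mulrC (addnC c) (addnC d).
Qed.

Lemma f_mom_sym01 x y c d : f_mom mu x.*2 y.*2 c d = f_mom mu y.*2 x.*2 c d.
Proof. by rewrite !f_momE moment_column_sym. Qed.

Lemma f_mom_sym23 a b x y : f_mom mu a b x.*2 y.*2 = f_mom mu a b y.*2 x.*2.
Proof. by rewrite !f_mom_swap_cols moment_column_sym. Qed.

Lemma f_mom_sym03 b c x y : f_mom mu x.*2 b c y.*2 = f_mom mu y.*2 b c x.*2.
Proof. by rewrite !f_momE moment_diagonal_sym. Qed.

Lemma f4_tperm (x y : 'I_4) (w : 'I_4 -> nat) : (forall i, ~~ odd (w i)) ->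
  f4 mu (fun i => w (tperm x y i)) = f4 mu w.
Proof.
move=> even_w; pose o k (lt_k : (k < 4)%N) : 'I_4 := Ordinal lt_k.
have half i : w i = (w i)./2.*2 by rewrite even_halfK.
(* The three other transpositions are conjugates: (02) of (23) by (03), (13) of (03) by (01), and
   (12) of (01) by (02). *)
have s02 a b c d : f_mom mu a.*2 b c.*2 d.*2 = f_mom mu c.*2 b a.*2 d.*2.
  by rewrite f_mom_sym03 f_mom_sym23 f_mom_sym03.
have s13 a b c d : f_mom mu a.*2 b.*2 c d.*2 = f_mom mu a.*2 d.*2 c b.*2.
  by rewrite f_mom_sym01 f_mom_sym03 f_mom_sym01.
have s12 a b c d : f_mom mu a.*2 b.*2 c.*2 d.*2 = f_mom mu a.*2 c.*2 b.*2 d.*2.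
  by rewrite s02 f_mom_sym01 s02.
have inordE k (lt_k : (k < 4)%N) : inord k = o k lt_k by apply/val_inj; rewrite /= inordK.
rewrite /f4 (inordE 0 isT) (inordE 1 isT) (inordE 2 isT) (inordE 3 isT).
have cases (z : 'I_4) : [\/ z = o 0 isT, z = o 1 isT, z = o 2 isT | z = o 3 isT].
  by case: z => [[|[|[|[|//]]]] lt_z];
    [constructor 1|constructor 2|constructor 3|constructor 4]; exact/val_inj.
rewrite !permE.
have [->|->|->|->] := cases x; have [->|->|->|->] := cases y; rewrite /=;
  rewrite (half (o 0 isT)) (half (o 1 isT)) (half (o 2 isT)) (half (o 3 isT));
  by [|exact: f_mom_sym01|exact: s02|exact: f_mom_sym03|exact: s12|exact: s13
      |exact: f_mom_sym23].
Qed.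

End BlockSymmetry.

Theorem theorem7p1 (R : realType) (n : nat) (mu : probability (Mx R n) R) :
  (2 <= n)%N -> is_Haar_On mu ->
  forall (s : 'S_4) (w : 'I_4 -> nat),
    (forall i, ~~ odd (w i)) ->
    f4 mu (fun i => w (s i)) = f4 mu w.
Proof.
case: n mu => [|[|m]]// mu _ haar s w even_w.
have [ts -> _] := prod_tpermP s.
elim: ts => [|[x y] ts IH].
  by rewrite big_nil; congr (f4 mu _); apply/funext => i; rewrite perm1.
(* [f4_tperm] is applied to [w] composed with the product over [ts], whose values are still even. *)
rewrite big_cons -IH -[RHS](f4_tperm haar x y)//.
by congr (f4 mu _); apply/funext => i; rewrite permM.
Qed.
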